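(* Let $X:[0,T]\to\mathbb{R}$ be a real-valued, centered, continuous Gaussian process with covariance $R_X(s,t)=\mathbb{E}X_sX_t$ and associated Cameron--Martin space $\mathcal{H}$. Let $\rho\ge 1$ and assume that $R_X$ has finite mixed $(1,\rho)$-variation in the 2D sense, i.e. $V_{1,\rho}(R_X;[0,T]^2)<\infty$. Then there is a continuous embedding $$\mathcal{H}\hookrightarrow C^{q\text{-var}}\qquad\text{with } q=\frac{1}{\frac{1}{2\rho}+\frac12}<2 .$$ More precisely, for every $h\in\mathcal{H}$, $$\|h\|_{q\text{-var};[s,t]}\le \|h\|_{\mathcal{H}}\sqrt{V_{1,\rho}(R_X;[s,t]^2)}\qquad\text{for all } [s,t]\subseteq[0,T].$$
   Context: Cameron--Martin space: $\mathcal{H}\subset C([0,T],\mathbb{R})$ consists of the functions $h_t=\mathbb{E}[ZX_t]$ with $Z$ in the $L^2$-closure of $\operatorname{span}\{X_t: t\in[0,T]\}$; if $h_t=\mathbb{E}[ZX_t]$ and $h'_t=\mathbb{E}[Z'X_t]$ with $Z,Z'$ in this closure, then $\langle h,h'\rangle_{\mathcal{H}}=\mathbb{E}[ZZ']$. For a function $h$ write $h_{s,t}=h_t-h_s$. The $q$-variation of $h$ on $[s,t]$ is $\|h\|_{q\text{-var};[s,t]}=\sup_{(t_i)\in\mathcal{D}([s,t])}\big(\sum_i|h_{t_i,t_{i+1}}|^q\big)^{1/q}$, where $\mathcal{D}([s,t])$ is the set of all (finite) dissections $s=t_0\le t_1\le\dots\le t_n=t$ of $[s,t]$. $C^{q\text{-var}}$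 is the space of continuous paths on $[0,T]$ with finite $q$-variation. Rectangular increments: $R\binom{s,t}{u,v}=R(s,u)-R(s,v)-R(t,u)+R(t,v)$. For $\gamma,\rho\ge1$ the mixed (right) $(\gamma,\rho)$-variation is $$V_{\gamma,\rho}(R;[s,t]\times[u,v])=\sup_{(t_i)\in\mathcal{D}([s,t]),\,(t'_j)\in\mathcal{D}([u,v])}\Big(\sum_{t'_j}\Big(\sum_{t_i}\Big|R\tbinom{t_i,t_{i+1}}{t'_j,t'_{j+1}}\Big|^{\gamma}\Big)^{\rho/\gamma}\Big)^{1/\rho}.$$ *)

(* Defs.v *)
From HB Require Import structures.
From mathcomp Require Import all_boot all_order all_algebra.
From mathcomp Require Import all_classical all_reals all_analysis.
From mathcomp Require Import measurable_realfun.

Set Implicit Arguments.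
Unset Strict Implicit.
Unset Printing Implicit Defensive.

Import Order.TTheory GRing.Theory Num.Theory.
Import numFieldNormedType.Exports.

Local Open Scope classical_set_scope.
Local Open Scope ring_scope.

Section variation.
Context {R : realType}.
Implicit Types (h : R -> R) (K : R -> R -> R) (s t u v : R) (l : seq R).

(* The dissection s = t_0 <= t_1 <= ... <= t_n = t is encoded by s together
   with the list l = [:: t_1; ...; t_n]; the points t_i are then the entries
   of s :: l. *)
Definition dissection s t l : Prop := path <=%R s l /\ last s l = t.

Definition qvar (q : R) h s t : \bar R :=
  ereal_sup [set ((\sum_(i < size l)
      `|h (s :: l)`_i.+1 - h (s :: l)`_i| `^ q) `^ q^-1)%:E
    | l in dissection s t].

Definition rect_incr K s t u v : R := K s u - K s v - K t u + K t v.

Definition mixed_var (gam rho : R) K s t u v : \bar R :=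
  ereal_sup [set x | exists l l', [/\ dissection s t l, dissection u v l' &
    x = ((\sum_(j < size l')
           (\sum_(i < size l)
              `|rect_incr K (s :: l)`_i (s :: l)`_i.+1
                            (u :: l')`_j (u :: l')`_j.+1| `^ gam)
           `^ (rho / gam)) `^ rho^-1)%:E]].

Definition Cqvar (T q : R) : set (R -> R) :=
  [set h | {within `[0, T], continuous h} /\ (qvar q h 0 T < +oo)%E].

(* the Banach norm of C^{q-var}: qvar alone vanishes on constant paths *)
Definition Cqvar_norm (T q : R) h : \bar R := (`|h 0|%:E + qvar q h 0 T)%E.

End variation.

(* A process on [0, T] is a family of random variables indexed by R, of which
   only the members with index in [0, T] are ever used. Likewise a path on
   [0, T] is a function on R, and only its values on [0, T] matter. *)
Section gaussian.
Context {R : realType} {d : measure_display} {Om : measurableType d}.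
Variables (P : probability Om R) (T : R) (X : R -> {RV P >-> R}).

(* normal_prob m 0 is not a point mass in the library, hence the case split *)
Definition gaussian_law (m sigma : R) (A : set R) : \bar R :=
  if sigma == 0 then \d_m A else normal_prob m sigma A.

Definition gaussian (Y : Om -> R) : Prop :=
  exists m sigma, 0 <= sigma /\
    forall A, measurable A -> pushforward P Y A = gaussian_law m sigma A.

Definition process_span : set (Om -> R) :=
  [set Y | exists n (a t : 'I_n -> R), (forall i, t i \in `[0, T]) /\
     Y = fun w => \sum_(i < n) a i * X (t i) w].

Definition gaussian_process : Prop :=
  forall Y, process_span Y -> gaussian Y.

Definition centered_process : Prop :=
  forall t : R, t \in `[0, T] -> ('E_P[X t] = 0)%E.

Definition continuous_process : Prop :=
  {ae P, forall w, {within `[0, T], continuous (fun t => X t w)}}.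

Definition cov (s t : R) : R := fine 'E_P[fun w => X s w * X t w].

Definition L2_closed_span : set (Om -> R) :=
  [set Z | Z \in Lfun P 2%:E /\ forall e : R, 0 < e ->
     exists2 Y, process_span Y & ('N[P]_2%:E[EFin \o (Z \- Y)%R] < e%:E)%E].

Definition cm_rep (h : R -> R) (Z : Om -> R) : Prop :=
  L2_closed_span Z /\
  forall t : R, t \in `[0, T] -> h t = fine 'E_P[fun w => Z w * X t w].

Definition cameron_martin : set (R -> R) :=
  [set h | exists Z, cm_rep h Z].

(* The representative is unique up to a null set, so that the choice below is
   immaterial: see cm_innerE. *)
Definition cm_inner (h h' : R -> R) : R :=
  fine 'E_P[fun w => xget (cst 0) (cm_rep h) w * xget (cst 0) (cm_rep h') w].

Definition cm_norm (h : R -> R) : R := Num.sqrt (cm_inner h h).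

Hypothesis X_L2 : forall t : R, t \in `[0, T] -> (X t : Om -> R) \in Lfun P 2%:E.

Let ip (f g : Om -> R) : R := fine 'E_P[fun w => f w * g w].

Let two_ge1 : (1 <= 2%:E :> \bar R)%E.
Proof. by rewrite lee_fin ler1n. Qed.

Let ip_fin (f g : Om -> R) : f \in Lfun P 2%:E -> g \in Lfun P 2%:E ->
  ('E_P[fun w => (f w * g w)%R])%E \is a fin_num.
Proof. by move=> f2 g2; apply/expectation_fin_num/Lfun2_mul_Lfun1. Qed.

Let ipC (f g : Om -> R) : ip f g = ip g f.
Proof. by rewrite /ip; congr (fine 'E_P[_]); apply/funext => w; rewrite mulrC. Qed.

Let ipBr (U f g : Om -> R) : U \in Lfun P 2%:E -> f \in Lfun P 2%:E ->
  g \in Lfun P 2%:E -> ip U (f \- g) = ip U f - ip U g.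
Proof.
move=> U2 f2 g2; rewrite /ip -fineB ?ip_fin//.
rewrite -[in RHS]expectationB; [|exact: Lfun2_mul_Lfun1|exact: Lfun2_mul_Lfun1].
by congr (fine 'E_P[_]); apply/funext => w /=; rewrite mulrBr.
Qed.

Let ip_le (f g : Om -> R) : f \in Lfun P 2%:E -> g \in Lfun P 2%:E ->
  (`|ip f g|%:E <= 'N[P]_2%:E[EFin \o f] * 'N[P]_2%:E[EFin \o g])%E.
Proof.
move=> f2 g2.
have mf : measurable_fun setT f by have := sub_Lfun_mfun f2; rewrite inE.
have mg : measurable_fun setT g by have := sub_Lfun_mfun g2; rewrite inE.
apply: (le_trans _ (@hoelder _ _ _ P f g 2 2 mf mg _ _ _)) => //; last first.
  by rewrite [RHS]splitr !div1r.
rewrite -abse_EFin fineK ?ip_fin// Lnorm1 unlock.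
apply: (le_trans (le_abse_integral _ _ _)) => //.
by apply/measurable_EFinP; exact: measurable_funM.
Qed.

Let span_L2 (n : nat) (a t : 'I_n -> R) : (forall i, t i \in `[0, T]) ->
  (fun w => \sum_(i < n) a i * X (t i) w) \in Lfun P 2%:E.
Proof.
elim: n a t => [|n IH] a t tT.
  rewrite (_ : (fun _ => _) = cst 0) ?Lfun_cst//.
  by apply/funext => w; rewrite big_ord0.
rewrite (_ : (fun _ => _) = (fun w =>
    \sum_(i < n) a (widen_ord (leqnSn n) i) * X (t (widen_ord (leqnSn n) i)) w)
    \+ (a ord_max \o* (X (t ord_max) : Om -> R))).
  by apply: (rpredD (IH _ _ _)) => //; apply: Lfun_scale; rewrite ?ler1n ?X_L2.
by apply/funext => w; rewrite big_ord_recr /= [X in _ + X]mulrC.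
Qed.

Let ip_span0 (U : Om -> R) (n : nat) (a t : 'I_n -> R) : U \in Lfun P 2%:E ->
  (forall s : R, s \in `[0, T] -> ip U (X s) = 0) -> (forall i, t i \in `[0, T]) ->
  ip U (fun w => \sum_(i < n) a i * X (t i) w) = 0.
Proof.
move=> U2 U0; elim: n a t => [|n IH] a t tT.
  rewrite /ip (_ : (fun _ => _) = cst 0) ?expectation_cst//.
  by apply/funext => w; rewrite big_ord0 mulr0.
pose t' i := t (widen_ord (leqnSn n) i); pose a' i := a (widen_ord (leqnSn n) i).
rewrite /ip (_ : (fun _ => _) =
  (U \* (fun w => \sum_(i < n) a' i * X (t' i) w))
  \+ (a ord_max \o* (U \* (X (t ord_max) : Om -> R)))); last first.
  apply/funext => w; rewrite big_ord_recr /= mulrDr; congr (_ + _).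
  by rewrite mulrCA mulrC.
have L1 : U \* (X (t ord_max) : Om -> R) \in Lfun P 1.
  by apply: Lfun2_mul_Lfun1 => //; exact: X_L2.
rewrite expectationD; last 2 first.
- by apply: Lfun2_mul_Lfun1 => //; apply: span_L2 => i; exact: tT.
- exact: Lfun_scale.
rewrite expectationZl// fineD ?fin_numM ?expectation_fin_num//; last first.
  by apply: Lfun2_mul_Lfun1 => //; apply: span_L2 => i; exact: tT.
rewrite fineM ?expectation_fin_num//=.
transitivity (0 + a ord_max * 0); last by rewrite mulr0 addr0.
congr (_ + _ * _); first exact: (IH a' t' (fun i => tT _)).
exact: (U0 _ (tT ord_max)).
Qed.

Let ip_closed0 (U Z : Om -> R) : U \in Lfun P 2%:E ->
  (forall s : R, s \in `[0, T] -> ip U (X s) = 0) -> L2_closed_span Z -> ip U Z = 0.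
Proof.
move=> U2 U0 [Z2 Zcl]; apply/normr0_eq0/eqP; rewrite eq_le normr_ge0 andbT.
apply/ler_addgt0Pl => e e0; rewrite addr0.
pose N := fine 'N[P]_2%:E[EFin \o U]%E.
have NE : 'N[P]_2%:E[EFin \o U]%E = N%:E.
  rewrite fineK// ge0_fin_numE ?Lnorm_ge0//.
  by have := sub_Lfun_finLfun U2; rewrite inE.
have N0 : 0 <= N by rewrite fine_ge0// Lnorm_ge0.
have N1 : 0 < N + 1 by rewrite ltr_wpDl.
have [Y [n [a [t [tT YE]]]] ZY] := Zcl (e / (N + 1)) (divr_gt0 e0 N1).
have Y2 : Y \in Lfun P 2%:E by rewrite YE; exact: span_L2.
have <- : ip U (Z \- Y) = ip U Z.
  by rewrite ipBr// [in X in _ - X]YE ip_span0 ?subr0.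
rewrite -lee_fin (le_trans (ip_le U2 (rpredB Z2 Y2)))// NE.
apply: (@le_trans _ _ (N%:E * (e / (N + 1))%:E)%E).
  by apply: lee_wpmul2l; [rewrite lee_fin|exact: ltW].
rewrite -EFinM lee_fin mulrCA ler_piMr ?(ltW e0)//.
by rewrite ler_pdivrMr// mul1r lerDl.
Qed.

Let cm_rep_ip (h : R -> R) (Z Z' W : Om -> R) :
  cm_rep h Z -> cm_rep h Z' -> L2_closed_span W -> ip Z W = ip Z' W.
Proof.
move=> [[Z2 Zcl] hZ] [[Z'2 Z'cl] hZ'] Wcl; have W2 := Wcl.1.
apply/eqP; rewrite -subr_eq0 ipC (ipC Z') -ipBr//; apply/eqP.
rewrite ipC; apply: ip_closed0 => //; first exact: rpredB.
move=> s sT; rewrite ipC ipBr ?X_L2// -!(ipC _ (X s)).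
by rewrite /ip -hZ// -hZ'// subrr.
Qed.

Lemma cm_innerE (h h' : R -> R) (Z Z' : Om -> R) : cm_rep h Z -> cm_rep h' Z' ->
  cm_inner h h' = fine 'E_P[fun w => Z w * Z' w].
Proof.
move=> hZ h'Z'; rewrite /cm_inner.
case: xgetP => [Z0 _ hZ0|/(_ Z)//]; case: xgetP => [Z0' _ h'Z0'|/(_ Z')//].
rewrite -!/(ip _ _) (cm_rep_ip hZ0 hZ h'Z0'.1) ipC.
by rewrite (cm_rep_ip h'Z0' h'Z' hZ.1) ipC.
Qed.

End gaussian.

(* Main.v *)
(* Write h_t = E[Z X_t] and let D_i be the increments of X over a dissection of
   [s, t]. By Cauchy-Schwarz, for all weights b,
     sum_i b_i h_{t_i, t_{i+1}} = E[Z sum_i b_i D_i]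
       <= |h|_H sqrt(sum_{i,j} b_i b_j E[D_i D_j]),
   and since E[D_i D_j] is symmetric, the double sum is at most
   sum_j b_j^2 sum_i |E[D_i D_j]|, which Hoelder's inequality bounds by
   |b|_{2 rho'}^2 V_{1,rho}. The exponent 2 rho' is conjugate to q, so the choice
   b_i = sgn(h_i) |h_i|^(q-1), with h_i the increments of h, gives the q-variation
   bound. Continuity of h holds because the increments of X are bounded in L^2 and
   X is almost surely continuous, so that X_u tends weakly in L^2 to X_t as u tends
   to t. *)
Require Import Defs.
From HB Require Import structures.
From mathcomp Require Import all_boot all_order all_algebra.
From mathcomp Require Import all_classical all_reals all_analysis.
From mathcomp Require Import measurable_realfun ring lra.

Import Order.TTheory GRing.Theory Num.Theory.
Import numFieldNormedType.Exports.

Local Open Scope classical_set_scope.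
Local Open Scope ring_scope.

(** * Integration against a measure with a density *)

Section density.
Import HBNNSimple.
Context {d : measure_display} {T : measurableType d} {R : realType}.
Variables (mu nu : {measure set T -> \bar R}) (g : T -> R).
Local Open Scope ereal_scope.
Hypotheses (mg : measurable_fun [set: T] g) (g0 : forall x, (0 <= g x)%R).
Hypothesis nuE : forall A, measurable A -> nu A = \int[mu]_(x in A) (g x)%:E.

(** The hypothesis on [nu] settles indicators, linearity extends this to nonnegative simple
    functions, and monotone convergence along [nnsfun_approx] reaches [f]. It turns integrals
    against [normal_prob] into Lebesgue integrals. *)
Lemma integral_density (f : T -> \bar R) :
  measurable_fun [set: T] f -> (forall x, 0 <= f x) ->
  \int[nu]_x f x = \int[mu]_x (f x * (g x)%:E).
Proof.
move=> mf f0.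
have mEg : measurable_fun [set: T] (EFin \o g) by exact/measurable_EFinP.
have indicE' (A : set T) : measurable A ->
    \int[nu]_x (\1_A x)%:E = \int[mu]_x ((\1_A x)%:E * (g x)%:E).
  move=> mA; rewrite integral_indic// setIT nuE// integral_mkcond.
  apply: eq_integral => x _; rewrite patchE indicE.
  by case: (x \in A); rewrite ?mul1e ?mul0e.
have simpleE (h : {nnsfun T >-> R}) :
    \int[nu]_x (h x)%:E = \int[mu]_x ((h x)%:E * (g x)%:E).
  under [LHS]eq_integral do rewrite fimfunE -fsumEFin//.
  rewrite ge0_integral_fsum//; last 2 first.
  - by move=> r; exact/measurable_EFinP/measurableT_comp.
  - by move=> n x _; rewrite EFinM nnfun_muleindic_ge0.
  under [RHS]eq_integral.
    move=> x _; rewrite fimfunE -fsumEFin// ge0_mule_fsuml; last first.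
      by move=> r; rewrite EFinM nnfun_muleindic_ge0.
    over.
  rewrite [RHS]ge0_integral_fsum//; last 2 first.
  - move=> r; apply: emeasurable_funM => //.
    by apply/measurable_EFinP/measurableT_comp.
  - by move=> n x _; apply: mule_ge0; rewrite ?EFinM ?nnfun_muleindic_ge0 ?lee_fin.
  apply: eq_fsbigr => r; rewrite inE => /= -[t _ rt].
  under eq_integral do rewrite EFinM.
  have r0 : 0 <= r%:E by rewrite -rt lee_fin.
  have mr : measurable (h @^-1` [set r]) by exact: measurable_sfunP.
  rewrite ge0_integralZl//; last exact/measurable_EFinP/measurable_indic.
  rewrite indicE'// -ge0_integralZl//.
  - by apply: eq_integral => x _; rewrite EFinM muleA.
  - by apply: emeasurable_funM => //; exact/measurable_EFinP/measurable_indic.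
  - by move=> x _; rewrite mule_ge0 ?lee_fin.
pose f_ := nnsfun_approx measurableT mf.
transitivity (limn (fun n => \int[nu]_x (f_ n x)%:E)).
  rewrite -monotone_convergence//=.
  - apply: eq_integral => x _; apply/esym/cvg_lim => //.
    exact: cvg_nnsfun_approx.
  - by move=> n; exact/measurable_EFinP.
  - by move=> n x _; rewrite lee_fin.
  - by move=> x _ a b ab; rewrite lee_fin; exact/lefP/nd_nnsfun_approx.
under eq_fun do rewrite simpleE.
rewrite -monotone_convergence//=.
- apply: eq_integral => x _; apply/cvg_lim => //.
  by apply: cvgeZr => //; exact: cvg_nnsfun_approx.
- by move=> n; apply: emeasurable_funM => //; exact/measurable_EFinP.
- by move=> n x _; rewrite mule_ge0 ?lee_fin.
- move=> x _ a b ab; apply: lee_wpmul2r; rewrite lee_fin//.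
  exact/lefP/nd_nnsfun_approx.
Qed.

End density.

(** * Square integrability of Gaussian variables *)

Section gaussian_moments.
Context {R : realType} {d : measure_display} {Om : measurableType d}.
Variable P : probability Om R.

Lemma integral_sqr_normal_lty (m s : R) : s != 0 ->
  (\int[normal_prob m s]_x ((x - m) ^+ 2)%:E < +oo)%E.
Proof.
move=> s0; pose s' := Num.sqrt 2 * s.
have s'0 : s' != 0 by rewrite mulf_neq0// gt_eqF// sqrtr_gt0.
(* The factor [4 * s ^+ 2] comes from (x - m)^2 = 4 s^2 u below, and the ratio of the peaks
   exchanges the two normalising constants. *)
pose C := 4 * s ^+ 2 * normal_peak s / normal_peak s'.
have C0 : 0 <= C.
  by rewrite divr_ge0 ?normal_peak_ge0// mulr_ge0 ?normal_peak_ge0// mulr_ge0 ?sqr_ge0.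
(* [u exp (- 2 u) <= exp (- u)] for [u = (x - m)^2 / (4 s^2)] compares with the
   normal density of standard deviation [s']. *)
have dom (x : R) : (x - m) ^+ 2 * normal_pdf m s x <= C * normal_pdf m s' x.
  rewrite !normal_pdfE// /normal_fun.
  have p'0 := normal_peak_gt0 s'0.
  rewrite /C [leRHS]mulrA divfK ?gt_eqF//.
  have [u uE] : exists u, u = (x - m) ^+ 2 / (4 * s ^+ 2) by eexists.
  have s20 : s ^+ 2 != 0 by rewrite sqrf_eq0.
  have -> : - (x - m) ^+ 2 / (s ^+ 2 *+ 2) = - u - u.
    by rewrite uE; field; rewrite s0.
  have -> : - (x - m) ^+ 2 / (s' ^+ 2 *+ 2) = - u.
    by rewrite uE /s' exprMn sqr_sqrtr//; field; rewrite s0.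
  have -> : (x - m) ^+ 2 = 4 * s ^+ 2 * u by rewrite uE; field; rewrite s0.
  have ue : u * expR (- u) <= 1.
    rewrite expRN ler_pdivrMr ?expR_gt0// mul1r.
    by apply: le_trans (expR_ge1Dx u); rewrite lerDr.
  have c0 : 0 <= 4 * s ^+ 2 * normal_peak s * expR (- u).
    by do 2 rewrite mulr_ge0 ?normal_peak_ge0 ?expR_ge0//; rewrite mulr_ge0 ?sqr_ge0.
  have := ler_wpM2l c0 ue; rewrite expRD mulr1; apply: le_trans.
  by rewrite le_eqVlt; apply/orP; left; apply/eqP; ring.
have msq : measurable_fun [set: R] (fun x : R => ((x - m) ^+ 2)%:E).
  apply: measurableT_comp => //; apply: measurable_funX => //.
  exact: measurable_funB.
have mpdf t : measurable_fun [set: R] (fun x : R => (normal_pdf m t x)%:E).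
  by apply: measurableT_comp => //; exact: measurable_normal_pdf.
rewrite (@integral_density _ _ _ lebesgue_measure _ (normal_pdf m s))//; last 3 first.
- exact: measurable_normal_pdf.
- by move=> x; exact: normal_pdf_ge0.
- by move=> x; rewrite lee_fin sqr_ge0.
apply: (@le_lt_trans _ _ (\int[lebesgue_measure]_x (C%:E * (normal_pdf m s' x)%:E))%E).
  apply: ge0_le_integral => //.
  - by move=> x _; rewrite mule_ge0// lee_fin ?sqr_ge0 ?normal_pdf_ge0.
  - exact: (emeasurable_funM msq (mpdf s)).
  - by apply: emeasurable_funM; [exact: measurable_cst|exact: (mpdf s')].
  by move=> x _; rewrite -!EFinM lee_fin.
rewrite ge0_integralZl//; last 2 first.
- exact: mpdf.
- by move=> x _; rewrite lee_fin normal_pdf_ge0.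
by rewrite integral_normal_pdf mule1 ltry.
Qed.

Lemma Lfun2_sqr_lty (f : Om -> R) : measurable_fun [set: Om] f ->
  (\int[P]_w (f w ^+ 2)%:E < +oo)%E -> f \in Lfun P 2%:E.
Proof.
move=> mf f2; rewrite inE; apply/andP; split; first by rewrite inE.
rewrite inE/= /finite_norm unlock poweR_lty//.
rewrite (eq_integral (fun w => (f w ^+ 2)%:E))// => w _.
by rewrite /= powR_mulrn// real_normK// num_real.
Qed.

(** Centering at [m] makes the integrand the one of [integral_sqr_normal_lty] after passing to the
    law of [Y]; the constant [m] is added back inside the vector space L^2. *)
Lemma gaussian_Lfun2 (Y : {RV P >-> R}) : gaussian P Y -> (Y : Om -> R) \in Lfun P 2%:E.
Proof.
move=> [m [s [_ YE]]].
have Yshift : (Y : Om -> R) = (fun w => Y w - m) \+ cst m.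
  by apply/funext => w /=; rewrite subrK.
suff L2 : (fun w => Y w - m) \in Lfun P 2%:E.
  by rewrite Yshift; apply: (rpredD L2 (Lfun_cst P m 2)); rewrite lee_fin ler1n.
apply: Lfun2_sqr_lty; first exact: measurable_funB.
(* [lebesgue_measure] and [normal_prob] live on [measurableTypeR R], whose display
   differs from that of the canonical measurable structure on [R]. *)
pose GR := measurableTypeR R.
have mY : measurable_fun [set: Om] (Y : Om -> GR).
  exact: (@measurable_funP _ _ _ _ setT Y).
pose Y' : {mfun Om >-> GR} :=
  HB.pack (Y : Om -> GR) (isMeasurableFun.Build _ _ Om GR (Y : Om -> GR) mY).
have msq : measurable_fun [set: GR] (fun x : GR => (((x : R) - m) ^+ 2)%:E).
  apply: measurableT_comp => //; apply: measurable_funX => //.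
  exact: measurable_funB.
have -> : (\int[P]_w ((Y w - m) ^+ 2)%:E =
    \int[distribution P Y']_x (((x : R) - m) ^+ 2)%:E)%E.
  rewrite ge0_integral_distribution// => x.
  by rewrite lee_fin sqr_ge0.
(* For [s = 0] the law is the Dirac mass at [m], so the integral is a single finite value. *)
move: YE; rewrite /gaussian_law; have [_|s0] := eqVneq s 0 => YE.
  rewrite (@eq_measure_integral _ GR _ _ (@dirac _ GR m R))//; last first.
    by move=> A mA _; exact: YE.
  by rewrite integral_dirac//= diracT mul1e ltry.
rewrite (@eq_measure_integral _ GR _ _ (normal_prob m s))//; last first.
  by move=> A mA _; exact: YE.
exact: integral_sqr_normal_lty.
Qed.

End gaussian_moments.

(** * Hoelder's inequality and l^q duality for finite sums *)

Section finite_sums.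
Context {R : realType}.

(** Induction on [r]: the two-term inequality [hoelder2] is applied to the head and to the l^p and
    l^q norms of the tail. *)
Lemma hoelder_sum {I : Type} (r : seq I) (a b : I -> R) (p q : R) :
  (forall i, 0 <= a i) -> (forall i, 0 <= b i) ->
  0 < p -> 0 < q -> p^-1 + q^-1 = 1 ->
  \sum_(i <- r) a i * b i <=
    (\sum_(i <- r) a i `^ p) `^ p^-1 * (\sum_(i <- r) b i `^ q) `^ q^-1.
Proof.
move=> a0 b0 p0 q0 pq; elim: r => [|i r IH].
  by rewrite big_nil mulr_ge0 ?powR_ge0.
have sumK (c : I -> R) (s : R) : 0 < s ->
    ((\sum_(j <- r) c j `^ s) `^ s^-1) `^ s = \sum_(j <- r) c j `^ s.
  move=> s0; rewrite -powRrM mulVf ?gt_eqF// powRr1//.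
  by apply: sumr_ge0 => j _; exact: powR_ge0.
rewrite !big_cons; apply: (le_trans (lerD (lexx _) IH)).
rewrite -[X in (_ + X) `^ p^-1](sumK a)// -[X in (_ + X) `^ q^-1](sumK b)//.
by apply: hoelder2 => //; exact: powR_ge0.
Qed.

(* Schur test: [b_i b_j K_ij <= (b_i^2 + b_j^2) |K_ij| / 2] *)
Lemma quadratic_form_le {n : nat} (K : 'I_n -> 'I_n -> R) (b : 'I_n -> R) :
  (forall i j, K i j = K j i) ->
  \sum_i \sum_j b i * b j * K i j <= \sum_j b j ^+ 2 * \sum_i `|K i j|.
Proof.
move=> Ksym.
pose W := \sum_j \sum_i b j ^+ 2 * `|K i j|.
have -> : \sum_j b j ^+ 2 * \sum_i `|K i j| = W.
  by apply: eq_bigr => j _; rewrite mulr_sumr.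
(* By symmetry of [K], [W] equals its transpose; averaging the two produces the mean of b_i^2 and
   b_j^2. *)
have WE : W = \sum_j \sum_i b i ^+ 2 * `|K i j|.
  rewrite exchange_big; apply: eq_bigr => j _; apply: eq_bigr => i _.
  by rewrite Ksym.
have -> : W = (W + W) / 2 by field.
rewrite {1}WE -big_split/= mulr_suml exchange_big; apply: ler_sum => j _.
rewrite -big_split/= mulr_suml; apply: ler_sum => i _.
rewrite -mulrDl [leRHS]mulrAC; apply: (le_trans (ler_norm _)); rewrite normrM.
apply: ler_wpM2r => //.
have := sqr_ge0 (b i - b j); have := sqr_ge0 (b i + b j).
by rewrite ler_norml => *; apply/andP; split; nra.
Qed.

(* The exponents satisfy [(q - 1) 2 rho' = q] and [1 - 1/q = 1/(2 rho')], where
   [rho'] is conjugate to [rho]. *)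
Lemma lq_norm_le_of_dual {n : nat} (x : 'I_n -> R) (K : 'I_n -> 'I_n -> R)
    (N rho q : R) :
  q = ((2 * rho)^-1 + 2^-1)^-1 -> 1 <= rho -> 0 <= N -> (forall i j, K i j = K j i) ->
  (forall b : 'I_n -> R,
    \sum_i b i * x i <= N * Num.sqrt (\sum_i \sum_j b i * b j * K i j)) ->
  (\sum_i `|x i| `^ q) `^ q^-1 <=
    N * Num.sqrt ((\sum_j (\sum_i `|K i j|) `^ rho) `^ rho^-1).
Proof.
move=> qdef rho1 N0 Ksym dual.
have rho0 : 0 < rho by exact: lt_le_trans rho1.
have rhoD : rho + 1 != 0 by rewrite gt_eqF// addr_gt0.
have qE : q = 2 * rho / (rho + 1) by rewrite qdef; field; lra.
have q0 : 0 < q by rewrite qE divr_gt0 ?mulr_gt0 ?addr_gt0.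
pose S := \sum_i `|x i| `^ q.
have S0 : 0 <= S by apply: sumr_ge0 => i _; exact: powR_ge0.
pose V := (\sum_j (\sum_i `|K i j|) `^ rho) `^ rho^-1.
rewrite -/S -/V.
have K0 j : 0 <= \sum_i `|K i j| by apply: sumr_ge0.
pose a j := (`|x j| `^ (q - 1)) ^+ 2.
have a0 j : 0 <= a j by exact: sqr_ge0.
have aK : \sum_j a j * (\sum_i `|K i j|) <= S `^ (1 - rho^-1) * V.
  (* For [rho = 1] the conjugate exponent is infinite and Hoelder's inequality is replaced by a
     direct check: then q = 1 and every [a j] is 1. *)
  move: (rho1); rewrite le_eqVlt => /predU1P[rhoE|rho_gt1].
    rewrite /V -rhoE invr1 subrr powRr0 mul1r powRr1; last first.
      by apply: sumr_ge0 => j _; exact: powR_ge0.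
    apply: ler_sum => j _; rewrite powRr1// /a qE -rhoE.
    have -> : 2 * 1 / (1 + 1) - 1 = 0 :> R by field.
    by rewrite powRr0 expr1n mul1r.
  have r1 : rho - 1 != 0 by rewrite subr_eq0 gt_eqF.
  pose rho' := rho / (rho - 1).
  have rho'0 : 0 < rho' by rewrite divr_gt0 ?subr_gt0.
  have rho'V : rho'^-1 = 1 - rho^-1 by rewrite /rho'; field; rewrite r1 gt_eqF.
  have pq : rho'^-1 + rho^-1 = 1 by rewrite rho'V subrK.
  apply: (le_trans (hoelder_sum _ _ _ _ _ a0 K0 rho'0 rho0 pq)); rewrite rho'V -/V.
  apply: ler_wpM2r; first exact: powR_ge0.
  rewrite le_eqVlt; apply/orP; left; apply/eqP; congr (_ `^ _).
  apply: eq_bigr => j _; rewrite /a -powR_mulrn ?powR_ge0// -!powRrM.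
  by congr (_ `^ _); rewrite qE /rho'; field; rewrite rhoD r1.
pose b j := Num.sg (x j) * `|x j| `^ (q - 1).
have bx : \sum_j b j * x j = S.
  apply: eq_bigr => j _; rewrite /b mulrAC -normrEsg.
  by rewrite mulr_powRB1.
have bK : \sum_i \sum_j b i * b j * K i j <= S `^ (1 - rho^-1) * V.
  apply: le_trans aK; apply: (le_trans (quadratic_form_le _ _ Ksym)).
  apply: ler_sum => j _; apply: ler_wpM2r => //.
  (* Only b_j^2 <= a_j holds in general: if q = 1 and x_j = 0, the convention 0^0 = 1 gives a_j = 1
     while b_j = 0. *)
  rewrite /b exprMn -[leRHS]mul1r; apply: ler_wpM2r => //.
  by rewrite sqr_sg; case: (x j != 0); rewrite ?lexx ?ler01.
have := dual b; rewrite bx => Sle.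
have [->|Sneq0] := eqVneq S 0.
  by rewrite powR0 ?invr_neq0 ?gt_eqF// mulr_ge0// sqrtr_ge0.
have S_gt0 : 0 < S by rewrite lt_neqAle eq_sym Sneq0.
(* Duality gives S <= N S^((1 - 1/rho)/2) sqrt V; cancelling this positive power of S leaves S^(1/q)
   on the left. *)
have c0 : 0 < S `^ ((1 - rho^-1) / 2) by exact: powR_gt0.
have SE : S `^ q^-1 * S `^ ((1 - rho^-1) / 2) = S.
  rewrite -(@powRD _ S) ?Sneq0 ?implybT//.
  have -> : q^-1 + (1 - rho^-1) / 2 = 1 by rewrite qE; field; lra.
  by rewrite powRr1.
rewrite -(ler_pM2r c0) SE; apply: (le_trans Sle); rewrite -mulrA; apply: (ler_wpM2l N0).
apply: (le_trans (ler_wsqrtr bK)).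
have Sc0 : 0 <= S `^ (1 - rho^-1) by exact: powR_ge0.
have -> : Num.sqrt (S `^ (1 - rho^-1) * V) = S `^ ((1 - rho^-1) / 2) * Num.sqrt V.
  by rewrite (sqrtrM V Sc0) (powRrM S (1 - rho^-1) 2^-1) (powR12_sqrt Sc0).
by rewrite mulrC.
Qed.

End finite_sums.

(** * The inner product of L^2, Cauchy-Schwarz and weak convergence *)

Section L2_inner.
Context {R : realType} {d : measure_display} {Om : measurableType d}.
Variable P : probability Om R.
Implicit Types f g h : Om -> R.

Definition inner f g : R := fine 'E_P[fun w => f w * g w].

Local Notation L2 := (Lfun P 2%:E).

Let two_ge1 : (1 <= 2%:E :> \bar R)%E.
Proof. by rewrite lee_fin ler1n. Qed.

Lemma Lfun2D f g : f \in L2 -> g \in L2 -> f \+ g \in L2.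
Proof. by move=> f2 g2; apply: (rpredD f2 g2). Qed.

Lemma Lfun2B f g : f \in L2 -> g \in L2 -> f \- g \in L2.
Proof. by move=> f2 g2; apply: (rpredB f2 g2). Qed.

Lemma Lfun2Z a f : f \in L2 -> (fun w => a * f w) \in L2.
Proof.
move=> f2; rewrite (_ : (fun _ => _) = a \o* f); first exact: Lfun_scale.
by apply/funext => w /=; rewrite mulrC.
Qed.

Lemma Lfun2_sum {I : Type} (r : seq I) (a : I -> R) (F : I -> Om -> R) :
  (forall i, F i \in L2) -> (fun w => \sum_(i <- r) a i * F i w) \in L2.
Proof.
move=> F2; elim: r => [|i r IH].
  rewrite (_ : (fun _ => _) = cst 0) ?Lfun_cst//.
  by apply/funext => w; rewrite big_nil.
rewrite (_ : (fun _ => _) = (fun w => a i * F i w) \+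
    (fun w => \sum_(j <- r) a j * F j w)); last first.
  by apply/funext => w; rewrite big_cons.
by apply: Lfun2D IH; exact: Lfun2Z.
Qed.

Lemma Lfun2_measurable f : f \in L2 -> measurable_fun [set: Om] f.
Proof. by move=> /sub_Lfun_mfun; rewrite inE. Qed.

Lemma inner_fin_num f g : f \in L2 -> g \in L2 ->
  ('E_P[fun w => (f w * g w)%R])%E \is a fin_num.
Proof. by move=> f2 g2; apply/expectation_fin_num/Lfun2_mul_Lfun1. Qed.

Lemma innerC f g : inner f g = inner g f.
Proof. by rewrite /inner; congr (fine 'E_P[_]); apply/funext => w; rewrite mulrC. Qed.

Lemma innerDr f g h : f \in L2 -> g \in L2 -> h \in L2 ->
  inner f (g \+ h) = inner f g + inner f h.
Proof.
move=> f2 g2 h2; rewrite /inner -fineD ?inner_fin_num//.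
rewrite -[in RHS]expectationD; [|exact: Lfun2_mul_Lfun1|exact: Lfun2_mul_Lfun1].
by congr (fine 'E_P[_]); apply/funext => w /=; rewrite mulrDr.
Qed.

Lemma innerZr a f g : f \in L2 -> g \in L2 ->
  inner f (fun w => a * g w) = a * inner f g.
Proof.
move=> f2 g2; rewrite /inner.
rewrite (_ : (fun _ => _) = a \o* (f \* g)); last first.
  by apply/funext => w /=; rewrite mulrCA mulrC.
by rewrite expectationZl ?Lfun2_mul_Lfun1// fineM ?inner_fin_num.
Qed.

Lemma innerBr f g h : f \in L2 -> g \in L2 -> h \in L2 ->
  inner f (g \- h) = inner f g - inner f h.
Proof.
move=> f2 g2 h2; rewrite -[inner f h]mul1r -mulNr -innerZr// -innerDr//.
  by congr inner; apply/funext => w /=; rewrite mulN1r.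
exact: Lfun2Z.
Qed.

Lemma inner_sumr {I : Type} (r : seq I) (a : I -> R) (F : I -> Om -> R) f :
  f \in L2 -> (forall i, F i \in L2) ->
  inner f (fun w => \sum_(i <- r) a i * F i w) = \sum_(i <- r) a i * inner f (F i).
Proof.
move=> f2 F2; elim: r => [|i r IH].
  rewrite big_nil /inner (_ : (fun _ => _) = cst 0) ?expectation_cst//.
  by apply/funext => w; rewrite big_nil mulr0.
rewrite big_cons -IH -innerZr// -innerDr//; [|exact: Lfun2Z|exact: Lfun2_sum].
by congr inner; apply/funext => w /=; rewrite big_cons.
Qed.

Lemma inner_ge0 f : 0 <= inner f f.
Proof. by apply/fine_ge0/expectation_ge0 => w; rewrite -expr2 sqr_ge0. Qed.

(** This is the expansion of E[(a f - b g)^2]. *)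
Lemma inner_quadratic_ge0 f g a b : f \in L2 -> g \in L2 ->
  0 <= a ^+ 2 * inner f f - 2 * a * b * inner f g + b ^+ 2 * inner g g.
Proof.
move=> f2 g2; have := inner_ge0 ((fun w => a * f w) \- (fun w => b * g w)).
have af2 := Lfun2Z a _ f2; have bg2 := Lfun2Z b _ g2.
rewrite innerBr ?Lfun2B// !(innerC (_ \- _)) !innerBr// !innerZr//.
rewrite !(innerC (fun w => _ * _)) !innerZr// (innerC g f).
by congr (_ <= _); ring.
Qed.

Lemma cauchy_schwarz f g : f \in L2 -> g \in L2 ->
  `|inner f g| <= Num.sqrt (inner f f) * Num.sqrt (inner g g).
Proof.
move=> f2 g2; rewrite -sqrtrM ?inner_ge0// -sqrtr_sqr; apply: ler_wsqrtr.
have comb a b := inner_quadratic_ge0 f g a b f2 g2.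
set A := inner f f in comb *; set B := inner f g in comb *.
set C := inner g g in comb *.
have : 0 <= C by exact: inner_ge0.
rewrite le_eqVlt => /predU1P[C0|C0].
  have [->|B0] := eqVneq B 0; first by rewrite -C0 mulr0 expr0n.
  (* With C = 0 and B nonzero, this choice gives the form the value A - (A + 1) = -1, a
     contradiction. *)
  have := comb 1 ((A + 1) / (2 * B)); rewrite -C0 mulr0 addr0.
  have -> : 2 * 1 * ((A + 1) / (2 * B)) * B = A + 1 by field.
  lra.
(* At (a, b) = (C, B) the form factors as C (A C - B^2), and C is positive. *)
have := comb C B.
have -> : C ^+ 2 * A - 2 * C * B * B + B ^+ 2 * C = C * (A * C - B ^+ 2) by ring.
by rewrite pmulr_rge0// subr_ge0.
Qed.

(** |f Y_n| is split into a part at most c Y_n^2, whose expectation is at most c M and hence small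
    with c, and an excess that tends to 0 in mean by dominated convergence. *)
Lemma inner_weak_cvg0 f (Y : nat -> Om -> R) (M : R) :
  f \in L2 -> (forall n, Y n \in L2) -> (forall n, inner (Y n) (Y n) <= M) ->
  {ae P, forall w, Y n w @[n --> \oo] --> 0} ->
  inner f (Y n) @[n --> \oo] --> 0.
Proof.
move=> f2 Y2 YM Ycvg.
have mf := Lfun2_measurable _ f2; have mY n := Lfun2_measurable _ (Y2 n).
apply/cvgrPdist_lt => e e0.
have M0 : 0 <= M := le_trans (inner_ge0 _) (YM 0%N).
have [c c0 cM] : exists2 c, 0 < c & c * M < e / 2.
  have M1 : 0 < M + 1 by rewrite ltr_wpDl.
  exists (e / (2 * (M + 1))); first by rewrite divr_gt0 ?mulr_gt0.
  rewrite invfM mulrA -mulrA gtr_pMr ?divr_gt0// mulrC.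
  by rewrite ltr_pdivrMr// mul1r ltrDl.
(* AM-GM: [|f Y| <= c Y^2 + f^2 / (4 c)], so the excess [g] of [|f Y|] over
   [c Y^2] is dominated by [f^2 / (4 c)]. *)
pose g n w : R := Num.max 0 (`|f w * Y n w| - c * Y n w ^+ 2).
have mg n : measurable_fun [set: Om] (g n).
  apply: measurable_maxr => //; apply: measurable_funB.
    by apply: measurableT_comp => //; exact: measurable_funM.
  by apply: measurable_funM => //; exact: measurable_funX.
have g0 n w : 0 <= g n w by rewrite /g le_max lexx.
pose G w : R := f w ^+ 2 * (4 * c)^-1.
have gG n w : g n w <= G w.
  have G0 : 0 <= G w by rewrite mulr_ge0 ?sqr_ge0// invr_ge0 mulr_ge0// ltW.
  rewrite /g ge_max G0 /G /=.
  rewrite ler_pdivlMr ?mulr_gt0//  normrM.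
  have -> : f w ^+ 2 = `|f w| ^+ 2 by rewrite real_normK ?num_real.
  have -> : Y n w ^+ 2 = `|Y n w| ^+ 2 by rewrite real_normK ?num_real.
  rewrite -subr_ge0.
  have -> : `|f w| ^+ 2 - (`|f w| * `|Y n w| - c * `|Y n w| ^+ 2) * (4 * c) =
    (`|f w| - 2 * c * `|Y n w|) ^+ 2 by ring.
  exact: sqr_ge0.
have iG : P.-integrable [set: Om] (EFin \o G).
  have /Lfun1_integrable := Lfun2_mul_Lfun1 (Lfun2Z (4 * c)^-1 _ f2) f2.
  by congr (integrable P _ _); apply/funext => w /=; congr EFin; rewrite /G; ring.
have gcvg : {ae P, forall w, [set: Om] w ->
    EFin (g n w) @[n --> \oo] --> (cst 0 w : \bar R)}.
  apply: filterS Ycvg => w Yw _; apply/cvg_EFin => /=; first by near=> n.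
  apply: (@squeeze_cvgr _ _ _ _ (cst 0) (fun n => `|f w * Y n w|)).
  - near=> n; rewrite g0/= /g ge_max normr_ge0/= lerBlDr lerDl.
    by rewrite mulr_ge0 ?sqr_ge0// ltW.
  - exact: cvg_cst.
  - rewrite -(normr0 R) -(mulr0 (f w)); apply: cvg_norm.
    by apply: cvgM => //; exact: cvg_cst.
have gdom : {ae P, forall w n, [set: Om] w -> (`|EFin (g n w)| <= EFin (G w))%E}.
  by apply: aeW => w n _; rewrite /= lee_fin ger0_norm.
have mEg n : measurable_fun [set: Om] (EFin \o g n) by exact/measurable_EFinP.
have [_ _] := dominated_convergence measurableT mEg (measurable_cst _) gcvg iG gdom.
rewrite integral0 => /fine_cvgP[_ /cvgrPdist_lt /(_ (e / 2))].
rewrite divr_gt0// => /(_ isT); apply: filterS => n /=; rewrite !sub0r !normrN => gn.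
have ig : P.-integrable [set: Om] (EFin \o g n).
  apply: le_integrable iG => // w _ /=.
  by rewrite lee_fin ger0_norm// ger0_norm// (le_trans (g0 n w)).
have iY : P.-integrable [set: Om] (EFin \o (fun w => c * (Y n w * Y n w))).
  apply/Lfun1_integrable; rewrite (_ : (fun _ => _) = (fun w => c * Y n w) \* Y n).
    by apply: Lfun2_mul_Lfun1 => //; exact: Lfun2Z.
  by apply/funext => w /=; rewrite mulrA.
(* Pointwise |f Y_n| <= g_n + c Y_n^2 by the definition of [g]; each of the two expectations is
   below e / 2. *)
apply: (@le_lt_trans _ _
  (fine (\int[P]_w (g n w)%:E) + c * inner (Y n) (Y n))); last first.
  have := YM n; have := ler_norm (fine (\int[P]_w (g n w)%:E)); nra.
rewrite -lee_fin -abse_EFin fineK ?inner_fin_num// EFinD fineK ?integrable_fin_num//.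
rewrite -innerZr// /inner fineK ?inner_fin_num ?Lfun2Z// unlock.
rewrite [X in (_ <= _ + X)%E](_ : _ =
    (\int[P]_w (c * (Y n w * Y n w))%:E)%E); last first.
  by apply: eq_integral => w _; congr EFin; rewrite mulrCA.
rewrite -integralD_EFin//; apply: (le_trans (le_abse_integral _ _ _)) => //.
  by apply/measurable_EFinP; exact: measurable_funM.
apply: ge0_le_integral => //.
- by apply/measurable_EFinP/measurableT_comp => //; exact: measurable_funM.
- apply/measurable_EFinP/measurable_funD => //.
  exact/measurable_EFinP/(measurable_int P).
move=> w _; rewrite /= lee_fin -expr2 -lerBlDr.
by rewrite /g le_max lexx orbT.
Unshelve. all: by end_near. Qed.

End L2_inner.

(** If continuity fails at [x], every ball of radius 1/(n+1) contains a bad point of [A], and choice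
    collects these into a sequence tending to [x]. The sequential form is what dominated convergence
    can feed. *)
Lemma within_continuous_seq {R : realType} (A : set R) (f : R -> R) :
  (forall x (u : nat -> R), A x -> (forall n, A (u n)) ->
    u n @[n --> \oo] --> x -> f (u n) @[n --> \oo] --> f x) ->
  {within A, continuous f}.
Proof.
move=> fseq; apply/subspace_continuousP => x Ax.
apply: contrapT => /cvgrPdist_lt/existsNP[e /not_implyP[e0 fx]].
have near_bad (n : nat) : exists y, [/\ A y, `|x - y| < n.+1%:R^-1 & e <= `|f x - f y|].
  apply: contrapT => nex; apply: fx; rewrite near_withinE.
  have : \forall y \near x, `|x - y| < n.+1%:R^-1.
    by apply: (@nbhsx_ballx _ R^o); rewrite invr_gt0 ltr0n.
  apply: filterS => y xy Ay; rewrite ltNge; apply/negP => efy.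
  by apply: nex; exists y.
have /choice[u uP] := near_bad.
have /cvgrPdist_lt /(_ _ e0) [N _ /(_ N (leqnn N))] : f (u n) @[n --> \oo] --> f x.
  apply: fseq => // [n|]; first by have [] := uP n.
  apply/cvgrPdist_lt => r r0; near=> n; have [_ un _] := uP n.
  apply: lt_trans un _; near: n; exact: near_infty_natSinv_lt (PosNum r0).
by have [_ _] := uP N; rewrite leNgt => /negP.
Unshelve. all: by end_near. Qed.

(** * Mixed variation sums along a single dissection *)

Section variation_lemmas.
Context {R : realType}.
Implicit Types (s t : R) (l : seq R).

Lemma dissection_nth s t l i : dissection s t l -> (i <= size l)%N ->
  s <= (s :: l)`_i <= t.
Proof.
move=> [sl <-] il; rewrite (last_nth 0).
have mono := sorted_leq_nth le_trans lexx 0 (sl : sorted <=%R (s :: l)).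
apply/andP; split; [apply: (mono 0%N i)|apply: (mono i (size l))] => //;
  by rewrite inE/= ltnS.
Qed.

(** Both coordinates share one dissection because the duality argument only meets covariances of
    increments along the same dissection. *)
Definition mixed_sum (rho : R) (K : R -> R -> R) s l : R :=
  (\sum_(j < size l) (\sum_(i < size l)
    `|rect_incr K (s :: l)`_i (s :: l)`_i.+1 (s :: l)`_j (s :: l)`_j.+1|)
      `^ rho) `^ rho^-1.

Lemma mixed_sum_le rho K s t l : dissection s t l ->
  ((mixed_sum rho K s l)%:E <= mixed_var 1 rho K s t s t)%E.
Proof.
move=> sl; apply: ereal_sup_ubound; exists l, l; split; [exact: sl|exact: sl|].
congr (_ `^ _)%:E; apply: eq_bigr => j _; rewrite divr1.
by congr (_ `^ _); apply: eq_bigr => i _; rewrite powRr1.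
Qed.

(** All terms except i = j = k are dropped from the two sums. For a covariance the remaining
    diagonal term is the second moment of an increment. *)
Lemma rect_incr_le_mixed_sum rho K s l (k : 'I_(size l)) : 0 < rho ->
  `|rect_incr K (s :: l)`_k (s :: l)`_k.+1 (s :: l)`_k (s :: l)`_k.+1|
    <= mixed_sum rho K s l.
Proof.
move=> rho0; set x := `|_|; rewrite /mixed_sum.
have -> : x = (x `^ rho) `^ rho^-1.
  by rewrite -powRrM mulfV ?gt_eqF// powRr1// normr_ge0.
have S0 j : 0 <= \sum_(i < size l)
    `|rect_incr K (s :: l)`_i (s :: l)`_i.+1 (s :: l)`_j (s :: l)`_j.+1|.
  exact: sumr_ge0.
apply: ge0_ler_powR; rewrite ?nnegrE ?invr_ge0 ?powR_ge0 ?sumr_ge0//.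
- exact: ltW.
- by move=> j _; exact: powR_ge0.
rewrite (bigD1 k)//= -[leLHS]addr0; apply: lerD; last first.
  by apply: sumr_ge0 => j _; exact: powR_ge0.
apply: (ge0_ler_powR (ltW rho0)); rewrite ?nnegrE ?normr_ge0 ?S0//.
by rewrite (bigD1 k)//= -[leLHS]addr0; apply: lerD => //; exact: sumr_ge0.
Qed.

End variation_lemmas.

(** * Variation and continuity of Cameron-Martin paths *)

Section embedding.
Context {R : realType} {d : measure_display} {Om : measurableType d}.
Variables (P : probability Om R) (T : R) (X : R -> {RV P >-> R}).
Hypothesis X_L2 : forall t : R, t \in `[0, T] -> (X t : Om -> R) \in Lfun P 2%:E.

Lemma rect_incr_cov (s t u v : R) : s \in `[0, T] -> t \in `[0, T] ->
  u \in `[0, T] -> v \in `[0, T] ->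
  rect_incr (cov X) s t u v = inner P (X t \- X s) (X v \- X u).
Proof.
move=> sT tT uT vT; rewrite /rect_incr /cov -!/(inner P _ _).
rewrite innerBr ?Lfun2B ?X_L2// !(innerC _ (_ \- _)) !innerBr ?X_L2//.
rewrite !(innerC _ (X v)) !(innerC _ (X u)); ring.
Qed.

(** Supplies the uniform L^2 bound on increments that [inner_weak_cvg0] asks for. *)
Lemma inner_incr_le (rho s t : R) : 0 < rho -> s \in `[0, T] -> t \in `[0, T] ->
  ((inner P (X t \- X s) (X t \- X s))%:E <= mixed_var 1 rho (cov X) 0 T 0 T)%E.
Proof.
move=> rho0; wlog st : s t / s <= t.
  move=> H sT tT; have [/H|/ltW/H] := leP s t; first exact.
  rewrite (_ : inner P (X s \- X t) _ = inner P (X t \- X s) (X t \- X s)); first exact.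
  by congr (fine 'E_P[_]); apply/funext => w /=; ring.
move=> sT tT; have := sT; have := tT; rewrite !in_itv/= => /andP[t0 tT'] /andP[s0 sT'].
(* The interval of index 1 in 0, s, t, T is [s, t], so its diagonal rectangle carries
   E[(X_t - X_s)^2]. *)
have dl : dissection 0 T [:: s; t; T] by split => //=; rewrite s0 st tT'.
apply: le_trans (mixed_sum_le rho (cov X) _ _ _ dl); rewrite lee_fin.
have := @rect_incr_le_mixed_sum _ rho (cov X) 0 [:: s; t; T] (@Ordinal 3 1 isT) rho0.
by rewrite /= rect_incr_cov//; apply: le_trans; exact: ler_norm.
Qed.

Variables (h : R -> R) (Z : Om -> R).
Hypothesis hZ : cm_rep T X h Z.

Let Z2 : Z \in Lfun P 2%:E.
Proof. by case: hZ => -[]. Qed.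

Lemma cm_normE : cm_norm T X h = Num.sqrt (inner P Z Z).
Proof. by rewrite /cm_norm (cm_innerE X_L2 hZ hZ). Qed.

Lemma cm_incr (s t : R) : s \in `[0, T] -> t \in `[0, T] ->
  h t - h s = inner P Z (X t \- X s).
Proof. by move=> sT tT; rewrite innerBr ?X_L2// !hZ.2. Qed.

Lemma qvar_le_mixed_var (rho q s t : R) : q = ((2 * rho)^-1 + 2^-1)^-1 ->
  1 <= rho -> 0 <= s -> t <= T ->
  (qvar q h s t <= (cm_norm T X h)%:E * sqrte (mixed_var 1 rho (cov X) s t s t))%E.
Proof.
move=> qE rho1 s0 tT; apply: ge_ereal_sup => _ [l sl <-].
pose D (i : 'I_(size l)) : Om -> R := X (s :: l)`_i.+1 \- X (s :: l)`_i.
have lT i : (i <= size l)%N -> (s :: l)`_i \in `[0, T].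
  move=> /(dissection_nth _ _ _ _ sl) /andP[sx xt].
  by rewrite in_itv/= (le_trans s0 sx) (le_trans xt).
have D2 i : D i \in Lfun P 2%:E.
  by apply: Lfun2B; apply: X_L2; apply: lT => //; exact: ltnW.
pose K i j := inner P (D i) (D j).
pose N := cm_norm T X h.
have N0 : 0 <= N by rewrite sqrtr_ge0.
have dual (b : 'I_(size l) -> R) :
    \sum_i b i * inner P Z (D i) <= N * Num.sqrt (\sum_i \sum_j b i * b j * K i j).
  have B2 : (fun w => \sum_i b i * D i w) \in Lfun P 2%:E by exact: Lfun2_sum.
  (* [K] is the Gram matrix of the increments, so the double sum is the squared L^2 norm of their
     combination, ready for Cauchy-Schwarz against [Z]. *)
  have -> : \sum_i \sum_j b i * b j * K i j =
      inner P (fun w => \sum_i b i * D i w) (fun w => \sum_i b i * D i w).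
    rewrite inner_sumr//; apply: eq_bigr => i _.
    rewrite innerC inner_sumr// mulr_sumr; apply: eq_bigr => j _.
    by rewrite mulrA.
  rewrite -inner_sumr// /N cm_normE.
  by apply: le_trans (ler_norm _) _; exact: cauchy_schwarz.
have := lq_norm_le_of_dual _ K N rho q qE rho1 N0 (fun i j => innerC P _ _) dual.
have -> : \sum_i `|inner P Z (D i)| `^ q =
    \sum_(i < size l) `|h (s :: l)`_i.+1 - h (s :: l)`_i| `^ q.
  by apply: eq_bigr => i _; rewrite cm_incr// lT// ltnW.
have -> : (\sum_j (\sum_i `|K i j|) `^ rho) `^ rho^-1 = mixed_sum rho (cov X) s l.
  congr (_ `^ _); apply: eq_bigr => j _; congr (_ `^ _); apply: eq_bigr => i _.
  by rewrite rect_incr_cov// lT// ltnW.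
move=> le; apply: (@le_trans _ _ (N * Num.sqrt (mixed_sum rho (cov X) s l))%:E).
  by rewrite lee_fin.
rewrite EFinM; apply: lee_wpmul2l; first by rewrite lee_fin.
have V0 := mixed_sum_le rho (cov X) _ _ _ sl.
rewrite -[leLHS]/(sqrte _%:E) lee_sqrt//.
by apply: le_trans V0; rewrite lee_fin powR_ge0.
Qed.

Lemma cm_continuous (rho : R) : continuous_process T X -> 0 < rho ->
  (mixed_var 1 rho (cov X) 0 T 0 T < +oo)%E -> {within `[0, T], continuous h}.
Proof.
move=> Xcont rho0 Voo; apply: within_continuous_seq => x u Ax Au ux.
have xT : x \in `[0, T] by exact: Ax.
have uT n : u n \in `[0, T] by exact: Au.
pose Y n : Om -> R := X (u n) \- X x.
have YE n : h (u n) - h x = inner P Z (Y n) by exact: cm_incr.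
suff : inner P Z (Y n) @[n --> \oo] --> 0.
  move=> Y0; apply/subr_cvg0; apply: cvg_trans Y0; apply: near_eq_cvg.
  by near=> n; rewrite YE.
apply: (@inner_weak_cvg0 _ _ _ _ _ _ (fine (mixed_var 1 rho (cov X) 0 T 0 T))) => //.
- by move=> n; apply: Lfun2B; apply: X_L2.
- move=> n; have le := inner_incr_le rho x (u n) rho0 xT (uT n).
  have V0 : (0 <= mixed_var 1 rho (cov X) 0 T 0 T)%E.
    by apply: le_trans le; rewrite lee_fin inner_ge0.
  have Vfin : mixed_var 1 rho (cov X) 0 T 0 T \is a fin_num by rewrite ge0_fin_numE.
  by rewrite -lee_fin (fineK Vfin).
apply: filterS Xcont => w /subspace_continuousP /(_ x Ax) Xw.
(* The paths of [X] are continuous only for the subspace topology, so [u] must converge to [x]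
   within [0, T]. *)
have uA : u n @[n --> \oo] --> within `[0, T]%classic (nbhs x).
  move=> B AB.
  have uB : \forall n \near \oo, `[0, T]%classic (u n) -> B (u n) by exact: (ux _ AB).
  have : \forall n \near \oo, B (u n) by apply: filterS uB => n; apply; exact: Au.
  exact.
by apply/subr_cvg0; exact: (cvg_comp _ _ uA Xw).
Unshelve. all: by end_near. Qed.

End embedding.

(** * From the Gaussian hypotheses to the embedding *)

Theorem theorem1p1 (R : realType) (d : measure_display) (Om : measurableType d)
    (P : probability Om R) (T : R) (X : R -> {RV P >-> R}) (rho : R) :
  0 < T ->
  gaussian_process T X ->
  centered_process T X ->
  continuous_process T X ->
  1 <= rho ->
  (mixed_var 1 rho (cov X) 0 T 0 T < +oo)%E ->
  let q := ((2 * rho)^-1 + 2^-1)^-1 in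
  [/\ q < 2,
      cameron_martin T X `<=` Cqvar T q,
      (exists C : R, forall h, cameron_martin T X h ->
        (Cqvar_norm T q h <= (C * cm_norm T X h)%:E)%E) &
      forall h, cameron_martin T X h ->
        forall s t : R, 0 <= s -> s <= t -> t <= T ->
        (qvar q h s t <=
           (cm_norm T X h)%:E * sqrte (mixed_var 1 rho (cov X) s t s t))%E].
Proof.
move=> T0 Xgauss _ Xcont rho1 Voo q.
have rho0 : 0 < rho by exact: lt_le_trans rho1.
have T0' : 0 \in `[0, T] by rewrite in_itv/= lexx ltW.
have X_L2 t : t \in `[0, T] -> (X t : Om -> R) \in Lfun P 2%:E.
  move=> tT; apply/gaussian_Lfun2/Xgauss.
  exists 1%N, (fun=> 1), (fun=> t); split => //.
  by apply/funext => w; rewrite big_ord1 mul1r.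
pose V := mixed_var 1 rho (cov X) 0 T 0 T.
have V0 : (0 <= V)%E.
  (* Nonnegativity of V is read off from the trivial increment X_0 - X_0. *)
  apply: le_trans (inner_incr_le _ _ _ X_L2 rho 0 0 rho0 T0' T0').
  by rewrite lee_fin inner_ge0.
have sV : sqrte V = (Num.sqrt (fine V))%:E.
  by rewrite -[in LHS](@fineK _ V)// ge0_fin_numE.
have qvarT h : cameron_martin T X h ->
    (qvar q h 0 T <= (cm_norm T X h * Num.sqrt (fine V))%:E)%E.
  by move=> [Z hZ]; rewrite EFinM -sV; exact: (qvar_le_mixed_var _ _ _ X_L2 _ _ hZ).
split.
- rewrite /q -[ltRHS]invrK ltf_pV2 ?posrE ?invr_gt0//.
    by rewrite ltrDr invr_gt0 mulr_gt0.
  by rewrite addr_gt0 ?invr_gt0 ?mulr_gt0.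
- move=> h [Z hZ]; split; first exact: (cm_continuous _ _ _ X_L2 _ _ hZ rho).
  by apply: le_lt_trans (ltry _); apply: qvarT; exists Z.
(* The first summand bounds |h_0| = |E[Z X_0]| by Cauchy-Schwarz, the second the q-variation on
   [0, T]. *)
- exists (Num.sqrt (inner P (X 0) (X 0)) + Num.sqrt (fine V)) => h hH.
  rewrite mulrDl EFinD /Cqvar_norm; apply: leeD; last first.
    by rewrite mulrC; exact: qvarT.
  have [Z hZ] := hH; rewrite lee_fin (cm_normE _ _ _ X_L2 _ _ hZ) mulrC hZ.2//.
  by apply: cauchy_schwarz; [case: hZ => -[]|exact: X_L2].
- move=> h [Z hZ] s t s0 _ tT.
  exact: (qvar_le_mixed_var _ _ _ X_L2 _ _ hZ).
Qed.
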